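(* Let $C_{(\neq,\neq)}(x,y)$ be the bivariate generating function of the Catalan words avoiding the ordered pair of relations $(\neq,\neq)$, where $x$ marks the length and $y$ marks the number of descents. Then $$C_{(\neq,\neq)}(x,y)=\frac{1 - x - x^2 - \sqrt{(1 - x - x^2)^2 - 4 x^4 y}}{2 x^4 y}.$$
   Context: A Catalan word of length $n$ is a word $w=w_1w_2\cdots w_n$ over the non-negative integers with $w_1=0$ and $0\leq w_i\leq w_{i-1}+1$ for $i=2,\dots,n$; the empty word is the unique Catalan word of length $0$. For relations $X,Y\in\{<,>,\leq,\geq,=,\neq\}$, a word $w$ contains the pattern $(X,Y)$ if there is an index $i\geq 1$ (with $i+2\le n$) such that $w_i\,X\,w_{i+1}$ and $w_{i+1}\,Y\,w_{i+2}$; otherwise $w$ avoids $(X,Y)$. The number of descents $\mathrm{des}(w)$ is the number of indices $i$ with $w_i>w_{i+1}$. The bivariate generating function is $C_{(X,Y)}(x,y)=\sum_{w}x^{|w|}y^{\mathrm{des}(w)}$, the sum being over all Catalan words $w$ (of any length $|w|\geq 0$) avoiding $(X,Y)$. Identities are between formal power series in $x$ with coefficients polynomials in $y$ (after clearing denominators); the square root of a power series with constant term $1$ is the one with constant term $1$. *)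

(* Defs.v *)
From HB Require Import structures.
From mathcomp Require Import all_boot all_order all_algebra.
From mathcomp Require Import boolp classical_sets.
Set Implicit Arguments.
Unset Strict Implicit.
Unset Printing Implicit Defensive.
Import GRing.Theory.
Local Open Scope ring_scope.

Record fps (R : Type) := Fps { fps_coef : nat -> R }.

Notation "{ 'fps' R }" := (fps R) (at level 0, format "{ 'fps'  R }").
Notation "f `[ n ]" := (fps_coef f n) (at level 2, format "f `[ n ]").

HB.instance Definition _ (R : Type) := gen_eqMixin {fps R}.
HB.instance Definition _ (R : Type) := gen_choiceMixin {fps R}.

Lemma fpsP (R : Type) (f g : {fps R}) : (forall n, f`[n] = g`[n]) -> f = g.
Proof. by case: f g => [f] [g] /= fg; congr Fps; apply/funext. Qed.

Definition fps_zero (R : comNzRingType) : {fps R} := Fps (fun=> 0).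
Definition fps_opp (R : comNzRingType) (f : {fps R}) := Fps (fun n => - f`[n]).
Definition fps_add (R : comNzRingType) (f g : {fps R}) :=
  Fps (fun n => f`[n] + g`[n]).
Definition fpsC (R : comNzRingType) (c : R) : {fps R} :=
  Fps (fun n => if n == 0%N then c else 0).
Definition fpsX (R : comNzRingType) : {fps R} := Fps (fun n => (n == 1%N)%:R).
Definition fps_mul (R : comNzRingType) (f g : {fps R}) :=
  Fps (fun n => \sum_(i < n.+1) f`[i] * g`[n - i]).

Section FpsRing.
Variable R : comNzRingType.
Implicit Types f g h : {fps R}.

Fact fps_addA : associative (@fps_add R).
Proof. by move=> f g h; apply: fpsP => n /=; rewrite addrA. Qed.

Fact fps_addC : commutative (@fps_add R).
Proof. by move=> f g; apply: fpsP => n /=; rewrite addrC. Qed.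

Fact fps_add0 : left_id (@fps_zero R) (@fps_add R).
Proof. by move=> f; apply: fpsP => n /=; rewrite add0r. Qed.

Fact fps_addN : left_inverse (@fps_zero R) (@fps_opp R) (@fps_add R).
Proof. by move=> f; apply: fpsP => n /=; rewrite addNr. Qed.

HB.instance Definition _ :=
  GRing.isZmodule.Build {fps R} fps_addA fps_addC fps_add0 fps_addN.

Fact fps_mulC : commutative (@fps_mul R).
Proof.
move=> f g; apply: fpsP => n /=; rewrite (reindex_inj rev_ord_inj) /=.
by apply: eq_bigr => i _; rewrite subSS subKn 1?mulrC // -ltnS.
Qed.

Fact fps_mulA : associative (@fps_mul R).
Proof.
have rev f g n : (fps_mul f g)`[n] = \sum_(i < n.+1) f`[n - i] * g`[i].
  by rewrite fps_mulC /=; apply: eq_bigr => i _; rewrite mulrC.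
move=> f g h; apply: fpsP => n; rewrite [RHS]rev [LHS]/=.
pose c3 j k := f`[j] * (g`[n - j - k] * h`[k]).
transitivity (\sum_(j < n.+1) \sum_(k < n.+1 | (k <= n - j)%N) c3 j k).
  apply: eq_bigr => /= j _; rewrite -[X in _ * X]/((fps_mul g h)`[n - j]) rev big_distrr /=.
  by rewrite (big_ord_narrow_leq (leq_subr _ _)).
rewrite (exchange_big_dep predT) //=; apply: eq_bigr => k _.
transitivity (\sum_(j < n.+1 | (j <= n - k)%N) c3 j k).
  apply: eq_bigl => j; rewrite -ltnS -(ltnS j) -!subSn ?leq_ord //.
  by rewrite -subn_gt0 -(subn_gt0 j) -!subnDA addnC.
rewrite (big_ord_narrow_leq (leq_subr _ _)) big_distrl /=.
by apply: eq_bigr => j _; rewrite /c3 -!subnDA addnC mulrA.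
Qed.

Fact fps_mul1 : left_id (fpsC 1) (@fps_mul R).
Proof.
move=> f; apply: fpsP => n /=; rewrite big_ord_recl subn0 mul1r.
by rewrite big1 ?addr0 // => i _; rewrite mul0r.
Qed.

Fact fps_mulDl : left_distributive (@fps_mul R) (@fps_add R).
Proof.
move=> f g h; apply: fpsP => n /=; rewrite -big_split /=.
by apply: eq_bigr => i _; rewrite mulrDl.
Qed.

Fact fps_1neq0 : fpsC 1 != 0 :> {fps R}.
Proof.
apply/eqP => /(congr1 (fun f : {fps R} => f`[0])) /= /eqP.
by rewrite (negPf (oner_neq0 _)).
Qed.

HB.instance Definition _ := GRing.Zmodule_isComNzRing.Build {fps R}
  fps_mulA fps_mulC fps_mul1 fps_mulDl fps_1neq0.

Lemma coef_fpsM f g n : (f * g)`[n] = \sum_(i < n.+1) f`[i] * g`[n - i].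
Proof. by []. Qed.

Lemma coef_fpsCM c f n : (fpsC c * f)`[n] = c * f`[n].
Proof.
by rewrite coef_fpsM big_ord_recl subn0 big1 ?addr0 // => i _; rewrite mul0r.
Qed.

Lemma coef_fpsXM f n :
  (fpsX R * f)`[n] = if n is m.+1 then f`[m] else 0.
Proof.
rewrite coef_fpsM big_ord_recl mul0r add0r.
case: n => [|n]; first by rewrite big_ord0.
rewrite big_ord_recl subSS subn0 mul1r big1 ?addr0 // => i _.
by rewrite mul0r.
Qed.

Lemma fpsC_lreg c : GRing.lreg c -> GRing.lreg (fpsC c).
Proof.
move=> creg f g fg; apply: fpsP => n; apply: creg.
by rewrite -!coef_fpsCM fg.
Qed.

Lemma fpsX_lreg : GRing.lreg (fpsX R).
Proof.
move=> f g fg; apply: fpsP => n.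
by have := congr1 (fun h : {fps R} => h`[n.+1]) fg; rewrite !coef_fpsXM.
Qed.

End FpsRing.

(* The square root with constant term 1 (junk value 0 if there is none). *)
Definition fps_sqrt (R : comNzRingType) (f : {fps R}) : {fps R} :=
  xget 0 [set s | s ^+ 2 = f /\ s`[0] = 1]%classic.

Section FpsSqrt.
Variable R : comUnitRingType.
Hypothesis unit2 : (2 : R) \is a GRing.unit.
Implicit Types f s t : {fps R}.

Fixpoint sqrt_seq f n : seq R :=
  if n is m.+1 then
    let s := sqrt_seq f m in
    rcons s (if m is k.+1 then
      (f`[m] - \sum_(i < k) s`_i.+1 * s`_(k - i)) / 2 else 1)
  else [::].

Let size_sqrt_seq f n : size (sqrt_seq f n) = n.
Proof. by elim: n => //= n IH; rewrite size_rcons IH. Qed.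

Let sqrt_seq_nth f n i : (i < n)%N ->
  (sqrt_seq f n)`_i = (sqrt_seq f i.+1)`_i.
Proof.
elim: n => // n IH; rewrite ltnS leq_eqVlt => /predU1P[->//|lt_in].
by rewrite [LHS]/= nth_rcons size_sqrt_seq lt_in IH.
Qed.

Let coef_sqr s n : s`[0] = 1 ->
  (s ^+ 2)`[n.+1] = s`[n.+1] *+ 2 + \sum_(i < n) s`[i.+1] * s`[n - i].
Proof.
move=> s0; rewrite expr2 coef_fpsM big_ord_recl big_ord_recr /= subn0 subnn.
rewrite s0 mul1r mulr1 addrCA mulr2n [RHS]addrC addrA; congr (_ + _ + _).
Qed.

Lemma fps_sqrt_ex f : f`[0] = 1 -> exists s, s ^+ 2 = f /\ s`[0] = 1.
Proof.
move=> f0; exists (Fps (fun n => (sqrt_seq f n.+1)`_n)); set s := Fps _.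
have s0 : s`[0] = 1 by [].
split=> //; apply: fpsP => -[|n].
  by rewrite expr2 coef_fpsM big_ord1 s0 mulr1 f0.
rewrite coef_sqr //.
have -> : s`[n.+1] = (f`[n.+1] - \sum_(i < n) s`[i.+1] * s`[n - i]) / 2.
  rewrite {1}/s -[LHS]/((rcons (sqrt_seq f n.+1) _)`_n.+1).
  rewrite nth_rcons size_sqrt_seq ltnn eqxx; congr ((_ - _) / _).
  apply: eq_bigr => i _; rewrite (@sqrt_seq_nth f n.+1 i.+1) ?ltnS //.
  by rewrite (@sqrt_seq_nth f n.+1 (n - i)) // ltnS leq_subr.
by rewrite -[_ / 2 *+ 2]mulr_natr divrK // subrK.
Qed.

Lemma fps_sqrt_uniq s t :
  s ^+ 2 = t ^+ 2 -> s`[0] = 1 -> t`[0] = 1 -> s = t.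
Proof.
move=> st s0 t0; apply: fpsP => n; elim/ltn_ind: n => -[|n] IH.
  by rewrite s0 t0.
have := congr1 (fun h : {fps R} => h`[n.+1]) st; rewrite !coef_sqr //.
under eq_bigr => i _ do rewrite !IH ?ltnS ?leq_subr // ?(ltn_ord i) //.
by move/addIr; rewrite -[_ *+ 2]mulr_natr -[t`[_] *+ 2]mulr_natr => /(mulIr unit2).
Qed.

Lemma fps_sqrtP f : f`[0] = 1 -> fps_sqrt f ^+ 2 = f /\ (fps_sqrt f)`[0] = 1.
Proof. by move/fps_sqrt_ex; apply: (@xgetPex _ 0). Qed.

Lemma fps_sqrt_eq f s : s ^+ 2 = f -> s`[0] = 1 -> fps_sqrt f = s.
Proof.
move=> sf s0; apply: xget_unique; first by split.
by move=> t [tf t0]; apply: fps_sqrt_uniq => //; rewrite tf sf.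
Qed.

End FpsSqrt.

(* The letter w_i of a word w = w_1 ... w_n is nth 0 w (i - 1). *)

Definition catalan (w : seq nat) : bool :=
  (head 0%N w == 0%N) && sorted [rel a b | b <= a.+1]%N w.

Definition contains (X Y : rel nat) (w : seq nat) : bool :=
  [exists i : 'I_(size w - 2),
     X (nth 0%N w i) (nth 0%N w i.+1) && Y (nth 0%N w i.+1) (nth 0%N w i.+2)].

Definition avoids (X Y : rel nat) (w : seq nat) : bool := ~~ contains X Y w.

Definition des (w : seq nat) : nat :=
  #|[set i : 'I_(size w - 1) | (nth 0 w i.+1 < nth 0 w i)%N]|.

(* A Catalan word of length n only has letters smaller than n (lemma
   catalan_tuple), so summing over n.-tuple 'I_n loses no word. *)
Definition catalan_gf (X Y : rel nat) : {fps {poly rat}} :=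
  Fps (fun n => \sum_(w : n.-tuple 'I_n |
                      catalan (map val w) && avoids X Y (map val w))
                  'X^(des (map val w))).

Lemma catalan_nth w i : catalan w -> (i < size w)%N -> (nth 0%N w i <= i)%N.
Proof.
case/andP => w0 /(sortedP 0%N) ws; elim: i => [|i IH] lt_iw.
  by rewrite nth0 (eqP w0).
by apply: leq_trans (ws _ lt_iw) _; rewrite ltnS IH // ltnW.
Qed.

Lemma catalan_tuple n w : catalan w -> size w = n ->
  exists! t : n.-tuple 'I_n, map val t = w.
Proof.
move=> cw <-{n}.
have lt_w (i : 'I_(size w)) : (nth 0%N w i < size w)%N.
  exact: leq_ltn_trans (catalan_nth cw (ltn_ord i)) (ltn_ord i).
pose t0 : (size w).-tuple 'I_(size w) := [tuple Ordinal (lt_w i) | i < size w].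
have t0w : map val t0 = w.
  rewrite -[RHS](mkseq_nth 0%N) /mkseq -val_enum_ord -!map_comp /=.
  exact: eq_map.
exists t0; split=> // t tw.
by apply/val_inj/(inj_map val_inj); rewrite tw.
Qed.

Definition neqr : rel nat := [rel a b | a != b].

(* Hence an identity multiplied by 2 x^4 y determines the quotient by it. *)
Lemma lreg_2X4y :
  GRing.lreg (2 * fpsX {poly rat} ^+ 4 * fpsC ('X : {poly rat})).
Proof.
have two : (2 : {fps {poly rat}}) = fpsC 2.
  by apply: fpsP => -[|n] //=; rewrite addr0.
rewrite two; do 2?apply: lregM.
- apply: fpsC_lreg; apply: mulfI.
  by rewrite -polyC_natr polyC_eq0.
- by apply: lregX; apply: fpsX_lreg.
- by apply: fpsC_lreg; apply: mulfI; rewrite polyX_eq0.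
Qed.

(* Main.v *)
(** An avoiding Catalan word is uniquely of one of the forms: empty; [0 t];
    [0 (0u + 1)]; or [0 (0u' + 1) 0 v], where [t], [u], [v] are avoiding
    Catalan words, [s + 1] raises every letter of [s] by one, and [u'] is [u]
    with its last letter repeated ([0] if [u] is empty).  The repetitions are
    forced by the pattern on both sides of the first rise and of the first
    return to [0], a descent.  Hence [C = 1 + x C + x^2 C + x^4 y C^2], and
    [1 - x - x^2 - 2 x^4 y C] squares to the radicand and has constant term 1. *)

Require Import Defs.
From mathcomp Require Import all_boot all_order all_algebra.
From mathcomp Require Import ring.
Import GRing.Theory.
Local Open Scope ring_scope.

(** * Letter-by-letter forms of avoidance and of descents *)

(* [w] may follow a word ending in [a], where [e] tells whether that word ends
   in two distinct letters.  With [e = true] and [a = 0] this forces [w] to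
   start with [0], so that it also characterises whole words. *)
Fixpoint extends (e : bool) (a : nat) (w : seq nat) : bool :=
  if w is b :: w' then
    [&& (b <= a.+1)%N, e ==> (a == b) & extends (a != b) b w']
  else true.

Fixpoint desc (a : nat) (w : seq nat) : nat :=
  if w is b :: w' then ((b < a) + desc b w')%N else 0.

Lemma avoids_cons3 (X Y : rel nat) a b c w :
  avoids X Y [:: a, b, c & w] = ~~ (X a b && Y b c) && avoids X Y [:: b, c & w].
Proof.
rewrite /avoids -negb_or /contains -!big_orE /= !subSS !subn0.
rewrite big_mkcond [in RHS]big_mkcond big_ord_recl /=.
by case: (X a b).
Qed.

Lemma avoids_small (X Y : rel nat) w : (size w <= 2)%N -> avoids X Y w.
Proof.
rewrite /avoids /contains -subn_eq0 => /eqP ->.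
by apply/existsPn => -[].
Qed.

Lemma des_sum w :
  des w = (\sum_(i < size w - 1) (nth 0 w i.+1 < nth 0 w i))%N.
Proof.
rewrite /des -sum1dep_card big_mkcond.
by apply: eq_bigr => i _; case: ltnP.
Qed.

(** No letter lies below 0, so the fictitious letter 0 in front adds no descent. *)
Lemma desE w : des w = desc 0 w.
Proof.
case: w => [|a w]; first by rewrite des_sum big_ord0.
elim: w a => [|b w IH] a; first by rewrite des_sum big_ord0.
by move: (IH b); rewrite !des_sum /= !subSS !subn0 big_ord_recl => ->.
Qed.

(** When [a != b], avoidance forces the next letter to repeat [b]; this is the test made by the
    flag. *)
Lemma extends_avoids a b w :
  extends (a != b) b w =
  path [rel a b | b <= a.+1]%N b w && avoids neqr neqr [:: a, b & w].
Proof.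
elim: w a b => [|c w IH] a b; first by rewrite avoids_small.
rewrite avoids_cons3 /= IH /neqr /= negb_and !negbK implyNb.
by case: (c <= b.+1)%N => //=; rewrite !andbA; congr (_ && _); rewrite andbC.
Qed.

Lemma extends_catalan w :
  extends true 0 w = catalan w && avoids neqr neqr w.
Proof.
case: w => [|a [|b w]]; rewrite /catalan; first by rewrite avoids_small.
  by rewrite avoids_small //; case: a => [|[]].
case: a => [|a]; last by rewrite /= andbF.
by rewrite /= extends_avoids andbA.
Qed.

(** * Shifting, repeating letters and concatenation *)

Lemma extends_mapS e a w : extends e a.+1 (map S w) = extends e a w.
Proof. by elim: w e a => //= b w IH e a; rewrite ltnS eqSS IH. Qed.

(** Repeating the last letter is always allowed and clears the flag, so [r] depends on [s] only
    through that letter. *)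
Lemma extends_rcons_last e a s r :
  extends e a (rcons s (last a s) ++ r) =
  extends e a s && extends false (last a s) r.
Proof.
elim: s e a => [|b s IH] e a /=; last by rewrite IH !andbA.
by rewrite leqnSn eqxx implybT.
Qed.

(** Were [b] different from the letter before it, the change from [b] to [c] would complete the
    pattern. *)
Lemma extends_last e a s b c r : b != c ->
  extends e a (rcons s b ++ c :: r) -> b = last a s.
Proof.
move=> bc; elim: s e a => [|d s IH] e a /=; last by case/and3P => _ _ /IH.
by case: (eqVneq a b) => //= _; rewrite (negPf bc) !andbF.
Qed.

Lemma desc_mapS a w : desc a.+1 (map S w) = desc a w.
Proof. by elim: w a => //= b w IH a; rewrite ltnS IH. Qed.

Lemma desc_cat a s r : desc a (s ++ r) = (desc a s + desc (last a s) r)%N.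
Proof. by elim: s a => //= b s IH a; rewrite IH addnA. Qed.

(** * The two gluing constructions *)

Definition glue_up (u : seq nat) : seq nat := [:: 0, 1 & map S u]%N.

Definition glue_down (p : seq nat * seq nat) : seq nat :=
  [:: 0, 1 & map S (rcons p.1 (last 0 p.1)) ++ 0 :: p.2]%N.

Lemma extends_cons0 t : extends true 0 t -> extends true 0 (0%N :: t).
Proof. by case: t => [|[|a] t] //=; rewrite andbF. Qed.

Lemma extends_glue_up u : extends true 0 (glue_up u) = extends true 0 u.
Proof. by rewrite -[RHS]extends_mapS. Qed.

(** The repeated letter clears the flag, which allows the drop to 0; that letter is positive, so the
    drop sets the flag again and [p.2] must start with 0. *)
Lemma extends_glue_down p :
  extends true 0 (glue_down p) = extends true 0 p.1 && extends true 0 p.2.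
Proof.
case: p => u v; rewrite -[LHS]/(extends true 1 _) map_rcons -last_map.
by rewrite extends_rcons_last extends_mapS last_map.
Qed.

Lemma desc_glue_up u : desc 0 (glue_up u) = desc 0 u.
Proof. by rewrite -[RHS]desc_mapS. Qed.

Lemma desc_glue_down p :
  desc 0 (glue_down p) = (desc 0 p.1 + desc 0 p.2).+1.
Proof.
case: p => u v; rewrite -[LHS]/(desc 1 _) desc_cat desc_mapS map_rcons.
rewrite last_rcons /= -cats1 desc_cat /= ltnn.
by rewrite add1n addnS !addn0.
Qed.

(** The four extra letters are 0, 1, the repeated letter and the 0 of the return; they account for
    the factor [x ^+ 4]. *)
Lemma size_glue_down p : size (glue_down p) = (size p.1 + size p.2).+4.
Proof.
by case: p => u v; rewrite /= size_cat size_map size_rcons /= addSnnS !addnS.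
Qed.

Lemma map_S_pred s : 0%N \notin s -> map S (map predn s) = s.
Proof.
by elim: s => //= -[|a] s IH; rewrite inE negb_or //= => /IH ->.
Qed.

Lemma notin0_mapS s : 0%N \notin map S s.
Proof. by apply/mapP => -[]. Qed.

Lemma glue_up_inj : injective glue_up.
Proof. by move=> u v [] /(inj_map succn_inj). Qed.

(** Raised letters are positive, so the first 0 after the initial one marks the cut. *)
Lemma glue_down_inj : injective glue_down.
Proof.
have idx s v : index 0%N (map S s ++ 0%N :: v) = size s.
  by rewrite index_cat (negPf (notin0_mapS s)) /= addn0 size_map.
move=> [u v] [u' v'] [] /= uv.
have sz : size (rcons u (last 0 u)%N) = size (rcons u' (last 0 u')%N).
  by rewrite -(idx _ v) uv idx.
have /eqP := uv; rewrite eqseq_cat ?size_map //.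
case/andP => /eqP /(inj_map succn_inj) uu /eqP [->].
by have [-> _] := rcons_inj uu.
Qed.

(** * Decomposition at the first return to 0 *)

Lemma extends_decomp w : extends true 0 w ->
  [\/ w = [::], exists2 t, w = 0%N :: t & extends true 0 t,
      exists2 u, w = glue_up u & extends true 0 u |
      exists2 p, w = glue_down p & extends true 0 p.1 && extends true 0 p.2].
Proof.
case: w => [|[|a] t]; [by constructor 1 | | by rewrite /= andbF].
case: t => [|[|[|//]] t] wt.
- by constructor 2; exists [::].
- by constructor 2; exists (0%N :: t).
have [t0|t0] := boolP (0%N \in t); last first.
  constructor 3; exists (map predn t); first by rewrite /glue_up map_S_pred.
  by rewrite -extends_glue_up /glue_up map_S_pred.
pose s := take (index 0%N t) t; pose v := drop (index 0%N t).+1 t.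
have s0 : 0%N \notin s by rewrite in_take // ltnn.
have def_t : t = s ++ 0%N :: v by rewrite -drop_index // cat_take_drop.
move: wt; rewrite def_t -(map_S_pred s s0).
move: (map predn s) => {s s0 def_t t0}.
(* An empty block is excluded: the changes 0 to 1 and 1 to 0 would be adjacent. *)
case/lastP => [//|u b] wt.
have := wt; rewrite map_rcons => /extends_last -/(_ isT).
rewrite last_map => -[def_b]; constructor 4; exists (u, v).
  by rewrite /glue_down -def_b map_rcons.
by rewrite -extends_glue_down /glue_down -def_b.
Qed.

(** * Enumeration of the words by length *)

Definition words (n : nat) : seq (seq nat) :=
  [seq map val (tval t) | t <- enum {: n.-tuple 'I_n}
                        & extends true 0 (map val (tval t))].

Definition word_pairs (n : nat) : seq (seq nat * seq nat) :=
  [seq p | i <- iota 0 n.+1,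
           p <- [seq (u, v) | u <- words i, v <- words (n - i)]].

Lemma mem_words n w : (w \in words n) = (size w == n) && extends true 0 w.
Proof.
apply/mapP/andP => [[t] | [/eqP sw gw]].
  by rewrite mem_filter => /andP[gt _] ->; rewrite size_map size_tuple eqxx.
have := gw; rewrite extends_catalan => /andP[cw _].
have [t [tw _]] := catalan_tuple cw sw.
by exists t; rewrite // mem_filter [X in extends _ _ X]tw gw mem_enum.
Qed.

Lemma words_uniq n : uniq (words n).
Proof.
rewrite map_inj_uniq ?filter_uniq -?enumT ?enum_uniq // => s t.
by move/(inj_map val_inj)/val_inj.
Qed.

Lemma mem_word_pairs n p :
  (p \in word_pairs n) =
  [&& size p.1 + size p.2 == n, extends true 0 p.1 & extends true 0 p.2]%N.
Proof.
case: p => u v; apply/allpairsPdep/and3P.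
  move=> [i [_ [i_n /allpairsP[[u' v'] [ui vi ->]] [-> ->]]]].
  move: i_n ui vi; rewrite mem_iota !mem_words.
  move=> i_n /andP[/eqP -> ->] /andP[/eqP -> ->].
  by split=> //; rewrite subnKC.
move=> [/eqP <- gu gv]; exists (size u), (u, v).
split=> //; first by rewrite mem_iota ltnS /= leq_addr.
by apply/allpairsP; exists (u, v); rewrite !mem_words /= addKn !eqxx.
Qed.

Lemma word_pairs_uniq n : uniq (word_pairs n).
Proof.
apply: allpairs_uniq_dep; first exact: iota_uniq.
  move=> i _; apply: allpairs_uniq; rewrite ?words_uniq //.
  by move=> [? ?] [? ?] _ _ [-> ->].
(* The index [i] is recovered as the length of the first component. *)
move=> _ _ /allpairsPdep[i [p [_ ip ->]]] /allpairsPdep[j [q [_ jq ->]]] /= pq.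
have size_fst k : q \in [seq (u, v) | u <- words k, v <- words (n - k)] ->
    size q.1 = k.
  by case/allpairsP => -[u v] [+ _ ->]; rewrite mem_words => /andP[/eqP].
by move: ip; rewrite pq => /size_fst <-; rewrite (size_fst _ jq).
Qed.

Lemma words_rec n :
  perm_eq (words n.+1)
    (map (cons 0%N) (words n)
     ++ (if n is m.+1 then map glue_up (words m) else [::])
     ++ (if n is m.+3 then map glue_down (word_pairs m) else [::])).
Proof.
apply: uniq_perm; first exact: words_uniq.
  rewrite !cat_uniq map_inj_uniq ?words_uniq; last by move=> ? ? [].
  have u2 : uniq (if n is m.+1 then map glue_up (words m) else [::]).
    by case: n => // m; rewrite map_inj_uniq ?words_uniq //; apply: glue_up_inj.
  have u3 : uniq (if n is m.+3 then map glue_down (word_pairs m) else [::]).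
    case: n {u2} => [|[|[|m]]] //.
    by rewrite map_inj_uniq ?word_pairs_uniq //; apply: glue_down_inj.
  rewrite u2 u3 /= andbT; apply/andP; split.
    (* In both glued forms the tail after the first letter starts with 1, so it is not a Catalan
       word. *)
    apply/hasPn => w; rewrite mem_cat => w23; apply/mapP => -[t].
    rewrite mem_words => /andP[_ gt] def_w; move: w23; rewrite {}def_w.
    case/orP; last first.
      case: n {u2 u3} => [|[|[|m]]] // /mapP[p _ [def_t]].
      by rewrite def_t in gt.
    by case: n {u2 u3} => // m /mapP[u _ [def_t]]; rewrite def_t in gt.
  (* Only [glue_down] produces a second 0. *)
  apply/hasPn => w; case: n {u2 u3} => [|[|[|m]]] // /mapP[p _ ->].
  apply/mapP => -[u _ [/(congr1 (fun s => 0%N \in s))]].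
  by rewrite mem_cat inE eqxx orbT (negPf (notin0_mapS u)).
move=> w; rewrite mem_words !mem_cat; apply/andP/or3P.
  move=> [/eqP sw /extends_decomp[w0|[t wt gt]|[u wu gu]|[p wp gp]]].
  - by rewrite w0 in sw.
  - constructor 1; rewrite wt map_f // mem_words gt andbT.
    by move: sw; rewrite wt => -[->].
  - constructor 2; move: sw; rewrite wu /= size_map => -[<-].
    by rewrite map_f // mem_words gu eqxx.
  - constructor 3; move: sw; rewrite wp size_glue_down => -[<-].
    by rewrite map_f // mem_word_pairs gp eqxx.
case.
- case/mapP => t; rewrite mem_words => /andP[/eqP <- gt] ->.
  by rewrite extends_cons0 /=.
- case: n => // m /mapP[u]; rewrite mem_words => /andP[/eqP <- gu] ->.
  by rewrite extends_glue_up gu /= size_map.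
- case: n => [|[|[|m]]] // /mapP[p]; rewrite mem_word_pairs.
  case/andP=> /eqP <- gp ->.
  by rewrite extends_glue_down size_glue_down gp eqxx.
Qed.

(** * The functional equation *)

Lemma coef_catalan_gf n :
  (catalan_gf neqr neqr)`[n] = \sum_(w <- words n) 'X^(desc 0 w).
Proof.
rewrite /= big_map big_filter big_enum_cond /=.
apply: eq_big => [t|t _]; first by rewrite extends_catalan.
by rewrite desE.
Qed.

Lemma sum_word_pairs n :
  \sum_(p <- word_pairs n) 'X^(desc 0 (glue_down p)) =
  'X * (catalan_gf neqr neqr * catalan_gf neqr neqr)`[n] :> {poly rat}.
Proof.
rewrite coef_fpsM big_allpairs_dep -[iota 0 n.+1]/(index_iota 0 n.+1).
rewrite big_mkord big_distrr; apply: eq_bigr => i _.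
rewrite !coef_catalan_gf big_allpairs_dep big_distrl big_distrr.
apply: eq_bigr => u _; rewrite !big_distrr; apply: eq_bigr => v _.
by rewrite desc_glue_down /= exprS exprD.
Qed.

(** Powers of [x] are written as nested products so that [coef_fpsXM] lowers the index one factor at
    a time. *)
Lemma catalan_gf_eq (x := fpsX {poly rat}) (y := fpsC ('X : {poly rat}))
    (C := catalan_gf neqr neqr) :
  C = 1 + x * C + x * (x * C) + y * (x * (x * (x * (x * (C * C))))).
Proof.
apply: fpsP => n.
rewrite -[RHS]/((1 : {fps {poly rat}})`[n] + (x * C)`[n] + (x * (x * C))`[n]
   + (y * (x * (x * (x * (x * (C * C))))))`[n]).
rewrite coef_fpsCM !coef_fpsXM.
case: n => [|n].
  rewrite coef_catalan_gf !addr0 mulr0 addr0 (perm_big [:: [::]]) ?big_seq1 //.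
  by apply: uniq_perm; rewrite ?words_uniq // => -[|a w]; rewrite mem_words.
rewrite coef_catalan_gf (perm_big _ (words_rec n)) !big_cat [LHS]/= addrA.
rewrite -[(1 : {fps {poly rat}})`[n.+1]]/(0 : {poly rat}) add0r.
congr (_ + _ + _).
- by rewrite big_map /C coef_catalan_gf.
- case: n => [|n]; first by rewrite coef_fpsXM big_nil.
  rewrite big_map coef_fpsXM /C coef_catalan_gf.
  by apply: eq_bigr => u _; rewrite desc_glue_up.
- case: n => [|[|[|n]]]; rewrite !coef_fpsXM ?big_nil ?mulr0 //.
  by rewrite big_map sum_word_pairs.
Qed.

(** * Solving the quadratic equation *)

Theorem theorem3p45 :
  let x : {fps {poly rat}} := fpsX {poly rat} in
  let y : {fps {poly rat}} := fpsC ('X : {poly rat}) in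
  2 * x ^+ 4 * y * catalan_gf neqr neqr
  = 1 - x - x ^+ 2 - fps_sqrt ((1 - x - x ^+ 2) ^+ 2 - 4 * x ^+ 4 * y).
Proof.
move=> x y; set C := catalan_gf neqr neqr.
have eqC : C = _ := catalan_gf_eq.
have unit2 : (2 : {poly rat}) \is a GRing.unit.
  by rewrite -polyC_natr poly_unitE coefC size_polyC.
rewrite (fps_sqrt_eq unit2 (s := 1 - x - x ^+ 2 - 2 * x ^+ 4 * y * C)).
- by ring.
(* Completing the square: the excess over the radicand is a multiple of the functional equation,
   hence zero. *)
- have -> : (1 - x - x ^+ 2 - 2 * x ^+ 4 * y * C) ^+ 2 =
    (1 - x - x ^+ 2) ^+ 2 - 4 * x ^+ 4 * y
    + 4 * x ^+ 4 * y * (1 + x * C + x * (x * C)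
                        + y * (x * (x * (x * (x * (C * C))))) - C) by ring.
  by rewrite -eqC subrr mulr0 addr0.
(* Factoring [x] out of all other terms exhibits the constant term 1. *)
- have -> : 1 - x - x ^+ 2 - 2 * x ^+ 4 * y * C =
    1 + x * (- 1 - x - 2 * x ^+ 3 * y * C) by ring.
  by rewrite -[LHS]/(1 + (x * _)`[0]) coef_fpsXM addr0.
Qed.
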